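(* Let $T=L_1\cdots L_pU_q\cdots U_1=F_1\cdots F_M$ be a positive bidiagonal factorization. For $a\in\{1,\dots,M\}$, the following conditions are equivalent: (i) $a\in\mathcal A_{\mathrm{cyc}}$; (ii) the cyclically ordered factors $F_a,\dots,F_M,F_1,\dots,F_{a-1}$ of $T_{(a)}$ can be transformed, by finitely many directed adjacent refactorizations $UL=\widetilde L\widetilde U$, into normalized positive bidiagonal factors whose lower--upper type sequence is $\sigma_{\mathrm{min}}$. When these conditions hold, the resulting factors $\widetilde F^{(a)}_1,\dots,\widetilde F^{(a)}_M$ are independent of the sequence of adjacent refactorizations and satisfy \[ T_{(a)}=\widetilde F^{(a)}_1\cdots\widetilde F^{(a)}_M . \] If the original factor coefficients are bounded, then the coefficients of the resulting factors are bounded. Moreover, this choice is maximal among the minimum-height patterns: if the factor-type sequence of a cyclic product can be transformed by directed exchanges $UL\mapsto LU$ into any sequence of height span $R-1$, then it can be transformed by directed exchanges into $\sigma_{\mathrm{min}}$.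
   Context: Let $p,q\ge1$, $M=p+q$, $d=\gcd(p,q)$, $P=p/d$, $Q=q/d$, $R=P+Q$. All matrices are semi-infinite, indexed by $\mathbb N_0$. A lower bidiagonal matrix $L$ is normalized if $L_{n,n}=1$ (coefficients $L_{n+1,n}$); an upper bidiagonal matrix $U$ is normalized if $U_{n,n+1}=1$ (coefficients $U_{n,n}$); such a matrix is positive if all its coefficients are strictly positive. In a positive bidiagonal factorization $T=L_1\cdots L_pU_q\cdots U_1$ the $L_i$ are normalized positive lower bidiagonal and the $U_b$ normalized positive upper bidiagonal. Put $F_a=L_a$ ($1\le a\le p$), $F_{p+b}=U_{q-b+1}$ ($1\le b\le q$), and $T_{(a)}=F_a\cdots F_MF_1\cdots F_{a-1}$. A directed adjacent refactorization of an ordered list of factors replaces two neighbouring factors $U,L$ (upper immediately before lower) by the unique normalized positive lower--upper pair $\widetilde L,\widetilde U$ with $UL=\widetilde L\widetilde U$. On type sequences (words in the symbols $L$, $U$) it acts as the directed exchange of neighbouring symbols $UL\mapsto LU$. Heights: for a sequence $\sigma=(\sigma_1,\dots,\sigma_M)$ with $p$ symbols $L$ and $q$ symbols $U$, put $\eta_0=0$ and $\eta_k=\eta_{k-1}+Q$ if $\sigma_k=L$, $\eta_k=\eta_{k-1}-P$ if $\sigma_k=U$. The height span of $\sigma$ is $\max_{0\le k\le M}\eta_k-\min_{0\le k\le M}\eta_k$. The minimum possible height span is $R-1$, and sequences attaining it are the minimum-height patterns. Let $r_k\in\{0,\dots,R-1\}$ be the remainder of $kQ$ modulo $R$. The sequence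 $\sigma_{\mathrm{min}}$ is defined by $\sigma_{\mathrm{min},k+1}=L$ if $r_k<P$ and $\sigma_{\mathrm{min},k+1}=U$ if $r_k\ge P$, for $k\in\{0,\dots,M-1\}$ (it contains $p$ symbols $L$ and $q$ symbols $U$ and has height span $R-1$). Index set: $c_-=\lceil P/Q\rceil$, $c_+=\lceil Q/P\rceil$, $a_-=p-c_-+1$, $a_+=p+1+\min\{q-1,c_+\}$, and $\mathcal A_{\mathrm{cyc}}=\{a_-,a_-+1,\dots,a_+\}$. *)

(* Defs.v *)
From Stdlib Require List.
From Stdlib Require Import Relation_Operators.
From mathcomp Require Import all_boot all_order all_algebra.
From mathcomp Require Import boolp classical_sets fsbigop reals.

Set Implicit Arguments.
Unset Strict Implicit.
Unset Printing Implicit Defensive.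

Import Order.TTheory GRing.Theory Num.Theory.
Local Open Scope ring_scope.

Section SemiInfiniteMatrices.
Variable R : realType.

Definition simatrix := nat -> nat -> R.

Definition sione : simatrix := fun i j => (i == j)%:R.

(* A finitely supported sum: it is the matrix product as soon as the rows of A
   have finite support, which is the case for all (products of) bidiagonal
   matrices. *)
Definition simul (A B : simatrix) : simatrix :=
  fun i j => \sum_(k \in [set: nat]) (A i k * B k j).

Definition siprod (s : seq simatrix) : simatrix := foldr simul sione s.

Definition pos_lower_bidiag (A : simatrix) : Prop :=
  [/\ forall n, A n n = 1,
      forall n, 0 < A n.+1 n &
      forall i j, i <> j -> i <> j.+1 -> A i j = 0].

Definition pos_upper_bidiag (A : simatrix) : Prop :=
  [/\ forall n, A n n.+1 = 1,
      forall n, 0 < A n n &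
      forall i j, i <> j -> j <> i.+1 -> A i j = 0].

End SemiInfiniteMatrices.

Inductive symbol := Lower | Upper.

Section Factors.
Variable R : realType.
Implicit Types (s t : seq (simatrix R)).

Definition has_type (x : symbol) (A : simatrix R) : Prop :=
  match x with Lower => pos_lower_bidiag A | Upper => pos_upper_bidiag A end.

Definition has_types (w : seq symbol) s : Prop := List.Forall2 has_type w s.

Definition coefficient (x : symbol) (A : simatrix R) (n : nat) : R :=
  match x with Lower => A n.+1 n | Upper => A n n end.

Definition bounded_coefficients (x : symbol) (A : simatrix R) : Prop :=
  exists C : R, forall n, `|coefficient x A n| <= C.

(* The pair (L', U') is not computed but characterised by the equation
   U L = L' U' between normalized positive bidiagonal matrices. *)
Definition refactor_step s t : Prop :=
  exists (s1 s2 : seq (simatrix R)) (U L L' U' : simatrix R),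
    [/\ s = s1 ++ [:: U; L] ++ s2,
        t = s1 ++ [:: L'; U'] ++ s2,
        pos_upper_bidiag U /\ pos_lower_bidiag L,
        pos_lower_bidiag L' /\ pos_upper_bidiag U' &
        simul U L = simul L' U'].

Definition refactors : seq (simatrix R) -> seq (simatrix R) -> Prop :=
  clos_refl_trans _ refactor_step.

End Factors.

Definition exchange_step (v w : seq symbol) : Prop :=
  exists w1 w2 : seq symbol,
    v = w1 ++ [:: Upper; Lower] ++ w2 /\ w = w1 ++ [:: Lower; Upper] ++ w2.

Definition exchanges : seq symbol -> seq symbol -> Prop :=
  clos_refl_trans _ exchange_step.

(* f a, ..., f M, f 1, ..., f (a - 1) *)
Definition cyclic_list (X : Type) (M a : nat) (f : nat -> X) : seq X :=
  map f (iota a (M.+1 - a)) ++ map f (iota 1 a.-1).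

Definition redp (p q : nat) : nat := (p %/ gcdn p q)%N.
Definition redq (p q : nat) : nat := (q %/ gcdn p q)%N.
Definition redr (p q : nat) : nat := (redp p q + redq p q)%N.

Section Factorization.
Variables (R : realType) (p q : nat) (L U : nat -> simatrix R).

(* L and U are indexed from 1; their values outside 1..p and 1..q are
   irrelevant. *)
Definition positive_bidiagonal_factorization (T : simatrix R) : Prop :=
  [/\ forall i, (1 <= i <= p)%N -> pos_lower_bidiag (L i),
      forall b, (1 <= b <= q)%N -> pos_upper_bidiag (U b) &
      T = siprod (map L (iota 1 p) ++ rev (map U (iota 1 q)))].

(* F_(p+b) = U_(q-b+1), for 1 <= b <= q *)
Definition factor (a : nat) : simatrix R :=
  if (a <= p)%N then L a else U (q - (a - p) + 1)%N.

Definition cyclic_factors (a : nat) : seq (simatrix R) :=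
  cyclic_list (p + q) a factor.

Definition cyclic_product (a : nat) : simatrix R := siprod (cyclic_factors a).

End Factorization.

Definition cyclic_word (p q a : nat) : seq symbol :=
  cyclic_list (p + q) a (fun k => if (k <= p)%N then Lower else Upper).

Definition height (p q : nat) (w : seq symbol) (k : nat) : int :=
  \sum_(x <- take k w)
    match x with Lower => (redq p q)%:Z | Upper => - (redp p q)%:Z end.

(* The default value 0 of the big operators is height p q w 0, hence harmless. *)
Definition height_span (p q : nat) (w : seq symbol) : int :=
  \big[Num.max/0]_(0 <= k < (size w).+1) height p q w k
  - \big[Num.min/0]_(0 <= k < (size w).+1) height p q w k.

Definition sigma_min (p q : nat) : seq symbol :=
  mkseq (fun k => if ((k * redq p q) %% redr p q < redp p q)%N
                  then Lower else Upper) (p + q).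

Definition c_minus (p q : nat) : int :=
  Num.ceil ((redp p q)%:R / (redq p q)%:R : rat).
Definition c_plus (p q : nat) : int :=
  Num.ceil ((redq p q)%:R / (redp p q)%:R : rat).

Definition a_minus (p q : nat) : int := p%:Z - c_minus p q + 1.
Definition a_plus (p q : nat) : int :=
  p%:Z + 1 + Num.min (q%:Z - 1) (c_plus p q).

Definition A_cyc (p q : nat) : pred nat :=
  [pred a : nat | a_minus p q <= a%:Z <= a_plus p q].

(* Main.v *)
Require Import Defs.
From Stdlib Require List.
From Stdlib Require Import Relation_Operators.
From mathcomp Require Import all_boot all_order all_algebra.
From mathcomp Require Import boolp classical_sets fsbigop reals.
From mathcomp Require Import zify ring lra.

Set Implicit Arguments.
Unset Strict Implicit.
Unset Printing Implicit Defensive.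

Import Order.TTheory GRing.Theory Num.Theory.
Local Open Scope ring_scope.

(** The theorem separates into an analytic fact about one pair of factors and
    a combinatorial fact about words.

    For one pair, comparing the entries of [U L = L' U'] gives the relations of
    the quotient-difference algorithm ([refactor_equation]). They can be solved
    recursively, the invariant [l n < u' n] keeping every denominator positive
    ([qd_upper_gt]), and a positive solution is unique and bounded by the sum
    of the bounds of [u] and [l]. Hence every exchange of symbols lifts to a
    refactorization of factors, and every refactorization projects to an
    exchange. Associativity of the semi-infinite product, which holds here
    because all rows have finite support ([simulA]), shows that the product of
    the factors is preserved.

    For words, [v] can be exchanged into [w] exactly when each prefix of [w]
    contains at least as many letters [Lower] as the prefix of [v] of the same
    length, the totals being equal. This order is [dominated]; being decided
    letter by letter, it turns reachability into a computation.

    Uniqueness of the resulting factors is Newman's argument relative to a fixed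
    target word. Two different steps act on disjoint pairs, so they commute,
    and the common reduct is still dominated by the target
    ([refactor_diamond]); the number of inversions decreases at each step, which
    supports the induction in [refactors_unique].

    For the index set, the word of the cyclic product either starts with
    [p - a + 1] letters [Lower] or ends with [a - p - 1] letters [Upper], and
    exchanges preserve such extreme runs. When all heights stay below
    [R = P + Q], such a run is at most [ceil (P / Q)], respectively
    [ceil (Q / P)], long: this is [low_heights_cyclic], and it applies to every
    reachable word of span [R - 1]. The height of [sigma_min] after [k] letters
    is [k Q mod R], so [sigma_min] is one of them. Conversely [sigma_min] has
    extreme runs of these lengths, and what remains after removing the
    run is a word [Upper^q' Lower^p'], from which every word with the same
    letters can be reached ([cyclic_exchanges]). Maximality of [sigma_min] follows
    since both reachability statements amount to the same condition on [a]. *)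

(** * Local rewriting of adjacent entries *)

(** Rewriting by [rule] at one place, as an inductive relation: the overlap
    analysis of two steps becomes a structural induction, which the description
    by an explicit position would not give. It serves both for factors and for
    symbols. *)
Inductive local_step (X : Type) (rule : X -> X -> X -> X -> Prop) :
    seq X -> seq X -> Prop :=
| local_here x y x' y' s :
    rule x y x' y' -> local_step rule (x :: y :: s) (x' :: y' :: s)
| local_there x s t :
    local_step rule s t -> local_step rule (x :: s) (x :: t).

Lemma local_stepP (X : Type) (rule : X -> X -> X -> X -> Prop) s t :
  local_step rule s t <->
  exists s1 s2 x y x' y', [/\ s = s1 ++ [:: x; y] ++ s2,
    t = s1 ++ [:: x'; y'] ++ s2 & rule x y x' y'].
Proof.
split=> [|[s1 [s2 [x [y [x' [y' [-> -> r]]]]]]]]; last first.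
  by elim: s1 => [|z s1 IH]; [exact: local_here | exact: local_there].
elim=> {s t} [x y x' y' s r|z s t _ [s1 [s2 [x [y [x' [y' [-> -> r]]]]]]]].
  by exists [::], s, x, y, x', y'.
by exists (z :: s1), s2, x, y, x', y'.
Qed.

Definition swap_rule (x y x' y' : symbol) : Prop :=
  [/\ x = Upper, y = Lower, x' = Lower & y' = Upper].

Lemma exchange_stepP v w : exchange_step v w <-> local_step swap_rule v w.
Proof.
rewrite local_stepP; split=> [[w1 [w2 [-> ->]]]|].
  by exists w1, w2, Upper, Lower, Lower, Upper.
by move=> [w1 [w2 [x [y [x' [y' [-> -> [-> -> -> ->]]]]]]]]; exists w1, w2.
Qed.

(** * Exchanges and the dominance order on words *)

Lemma exchanges_trans v w x : exchanges v w -> exchanges w x -> exchanges v x.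
Proof. exact: rt_trans. Qed.

Lemma exchanges_refl v : exchanges v v. Proof. exact: rt_refl. Qed.

Lemma exchanges_context u v w t :
  exchanges v w -> exchanges (u ++ v ++ t) (u ++ w ++ t).
Proof.
elim=> {v w} [v w [w1 [w2 [-> ->]]]|v|v w x _ IHv _ IHw].
- apply: rt_step; exists (u ++ w1), (w2 ++ t).
  by rewrite -!catA.
- exact: exchanges_refl.
- exact: exchanges_trans IHv IHw.
Qed.

Lemma exchanges_cons x v w : exchanges v w -> exchanges (x :: v) (x :: w).
Proof. by move=> /(exchanges_context [:: x] [::]); rewrite !cats0. Qed.

Lemma exchanges_head v : exchanges (Upper :: Lower :: v) (Lower :: Upper :: v).
Proof. by apply: rt_step; exists [::], v. Qed.

(** The dominance order, read from left to right: [n] is the number of letters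
    [Lower] by which the part of [w] already read exceeds that of [v]. It must
    never become negative, and it is zero at the end. *)
Fixpoint dominated (n : nat) (v w : seq symbol) : bool :=
  match v, w with
  | [::], [::] => n == 0%N
  | Lower :: v', Lower :: w' => dominated n v' w'
  | Upper :: v', Upper :: w' => dominated n v' w'
  | Upper :: v', Lower :: w' => dominated n.+1 v' w'
  | Lower :: v', Upper :: w' => (0 < n)%N && dominated n.-1 v' w'
  | _, _ => false
  end.

Lemma dominated_refl w : dominated 0 w w.
Proof. by elim: w => [|[] w]. Qed.

Lemma dominated_step n v v' w :
  local_step swap_rule v v' -> dominated n v' w -> dominated n v w.
Proof.
move=> vv'; elim: vv' n w => {v v'} [x y x' y' v [-> -> -> ->]|x v v' _ IH] n.
  by case=> [|[] [|[] w]] //=; case: n.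
by case: x; case=> [|[] w] //=; do ?[exact: IH]; case: n => //= n; exact: IH.
Qed.

Lemma exchanges_dominated v w : exchanges v w -> dominated 0 v w.
Proof.
suff H n x : exchanges v w -> dominated n w x -> dominated n v x.
  by move=> vw; apply: H vw _; exact: dominated_refl.
move=> vw; elim: vw n x => {v w} [v w /exchange_stepP s|//|v w x _ H1 _ H2] n y.
  exact: dominated_step.
by move/H2/H1.
Qed.

(** The inductive step of completeness: when [w] starts with [Lower] and [v]
    does not, the first [Lower] of [v] is moved to the front. The surplus [n.+1]
    guarantees that [v] contains one. *)
Lemma dominated_pull n v w : dominated n.+1 v w ->
  exists2 v', exchanges (Upper :: v) (Lower :: v') & dominated n v' w.
Proof.
elim: v n w => [|[] v IH] n; first by case=> [|[]].
  case=> [|[] w] //= d; exists (Upper :: v) => //; exact: exchanges_head.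
have up v' : exchanges (Upper :: v) (Lower :: v') ->
    exchanges [:: Upper, Upper & v] [:: Lower, Upper & v'].
  by move=> /(exchanges_cons Upper) e; apply: exchanges_trans e (exchanges_head _).
by case=> [|[] w] //= /IH [v' /up e d]; exists (Upper :: v').
Qed.

Lemma dominated_exchanges v w : dominated 0 v w -> exchanges v w.
Proof.
elim: w v => [|[] w IH] [|[] v] //=; first by move=> _; exact: exchanges_refl.
- by move/IH; exact: exchanges_cons.
- move=> /dominated_pull [v' e d]; apply: exchanges_trans e _.
  exact/exchanges_cons/IH.
- by move/IH; exact: exchanges_cons.
Qed.

(** The word after both of two commuting exchanges is the join of the words
    after each of them, hence it has the same upper bounds. *)
Lemma dominated_join n (v1 v2 w : seq symbol) :
  dominated n (Lower :: Upper :: v1) w -> dominated n (Upper :: Lower :: v2) w ->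
  dominated n (Lower :: Upper :: v2) w.
Proof. by case: w => [|[] [|[] w]] //=; case: n. Qed.

(** * Invariants of exchanges *)

Definition is_lower x := if x is Lower then true else false.

Fixpoint inversions (w : seq symbol) : nat :=
  match w with
  | [::] => 0
  | Lower :: w' => inversions w'
  | Upper :: w' => count is_lower w' + inversions w'
  end.

Lemma count_step (a : pred symbol) v w :
  local_step swap_rule v w -> count a v = count a w.
Proof.
elim=> {v w} [x y x' y' v [-> -> -> ->]|x v w _ /= ->] //=.
by rewrite addnCA.
Qed.

Lemma count_exchanges (a : pred symbol) v w :
  exchanges v w -> count a v = count a w.
Proof.
elim=> {v w} [v w /exchange_stepP|//|v w x _ -> _ //]; exact: count_step.
Qed.

Lemma size_exchanges v w : exchanges v w -> size v = size w.
Proof. by rewrite -!count_predT; exact: count_exchanges. Qed.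

Lemma inversions_step v w :
  local_step swap_rule v w -> (inversions w < inversions v)%N.
Proof.
elim=> {v w} [x y x' y' v [-> -> -> ->]|x v w s /= IH] /=.
  by rewrite add1n addSn ltnS.
by case: x => //; rewrite (count_step is_lower s) ltn_add2l.
Qed.

Lemma inversions_exchanges v w : exchanges v w -> (inversions w <= inversions v)%N.
Proof.
elim=> {v w} [v w /exchange_stepP /inversions_step/ltnW //|//|v w x _ vw _ wx].
exact: leq_trans wx vw.
Qed.

(** A leading run of [Lower] is already as far to the left as possible, so it
    survives every exchange. *)
Lemma dominated_prefix m v w : dominated 0 (nseq m Lower ++ v) w ->
  exists w', w = nseq m Lower ++ w'.
Proof.
elim: m w => [|m IH] w /=; first by exists w.
by case: w => [|[] w] //= /IH [w' ->]; exists w'.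
Qed.

Lemma exchanges_prefix m v w : exchanges (nseq m Lower ++ v) w ->
  exists w', w = nseq m Lower ++ w'.
Proof. by move/exchanges_dominated/dominated_prefix. Qed.

Definition opposite x := if x is Lower then Upper else Lower.
(** Reversing a word and interchanging its two letters maps [Upper Lower] to
    itself and [Lower Upper] to itself: this symmetry of exchanges transfers
    the result on initial runs to final runs. *)
Definition dual_word w := rev (map opposite w).

Lemma dual_wordK : involutive dual_word.
Proof.
by move=> w; rewrite /dual_word map_rev revK mapK // => -[].
Qed.

Lemma dual_word_cat v w : dual_word (v ++ w) = dual_word w ++ dual_word v.
Proof. by rewrite /dual_word map_cat rev_cat. Qed.

Lemma dual_word_nseq n x : dual_word (nseq n x) = nseq n (opposite x).
Proof. by rewrite /dual_word map_nseq rev_nseq. Qed.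

Lemma exchanges_dual v w : exchanges v w -> exchanges (dual_word v) (dual_word w).
Proof.
elim=> {v w} [v w [w1 [w2 [-> ->]]]|v|v w x _ IHv _ IHw].
- apply: rt_step; exists (dual_word w2), (dual_word w1).
  by rewrite !dual_word_cat -!catA.
- exact: exchanges_refl.
- exact: exchanges_trans IHv IHw.
Qed.

Lemma exchanges_suffix m v w : exchanges (v ++ nseq m Upper) w ->
  exists w', w = w' ++ nseq m Upper.
Proof.
move/exchanges_dual; rewrite dual_word_cat dual_word_nseq => /exchanges_prefix.
move=> [w' e]; exists (dual_word w').
by rewrite -[w]dual_wordK e dual_word_cat dual_word_nseq.
Qed.

(** [Upper^q Lower^r] is the least word with its letters. *)
Lemma dominated_bottom n q r w :
  size w = (q + r)%N -> r = (n + count is_lower w)%N ->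
  dominated n (nseq q Upper ++ nseq r Lower) w.
Proof.
elim: w n q r => [|x w IH] n q r /=.
  by case: q r => [|q] [|r] //= _; rewrite addn0 => <-.
case: q => [|q] /=; last first.
  by case: x => /= -[hs] hr; apply: IH => //; rewrite hr ?addSnnS.
have hc : (count is_lower w <= size w)%N := count_size _ _.
case: r => [|r] //= [hs]; case: x => /= hr; first by apply: (IH n 0%N) => //; lia.
by apply/andP; split; [|apply: (IH n.-1 0%N) => //]; lia.
Qed.

Lemma exchanges_bottom q r w : size w = (q + r)%N -> count is_lower w = r ->
  exchanges (nseq q Upper ++ nseq r Lower) w.
Proof. by move=> h1 h2; apply/dominated_exchanges/dominated_bottom. Qed.

(** * Products of banded semi-infinite matrices *)

Section MatrixProducts.
Variable R : realType.
Implicit Types A B C : simatrix R.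

Definition banded (b : nat) A : Prop := forall i k, (i + b < k)%N -> A i k = 0.

Lemma simulE N A B i j : (forall k, (N <= k)%N -> A i k = 0) ->
  simul A B i j = \sum_(k < N) A i k * B k j.
Proof.
move=> A0; rewrite /simul (fsbig_ord _ N (fun k => A i k * B k j)).
apply/esym/fsbig_widen => // k [_ /= kN].
by rewrite A0 ?mul0r // leqNgt; apply/negP.
Qed.

Lemma simul_banded b c A B : banded b A -> banded c B -> banded (b + c) (simul A B).
Proof.
move=> hA hB i k hk; rewrite (@simulE (i + b).+1) => [|m /hA //].
by apply: big1 => m _; rewrite hB ?mulr0 //; have := ltn_ord m; lia.
Qed.

(** Associativity fails for arbitrary semi-infinite matrices, whose products
    are not defined by finite sums; bands make the rows finite. *)
Lemma simulA b c A B C : banded b A -> banded c B ->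
  simul (simul A B) C = simul A (simul B C).
Proof.
move=> hA hB; apply/funext => i; apply/funext => j.
have hAB := simul_banded hA hB.
rewrite (@simulE (i + (b + c)).+1) => [|m /hAB //].
rewrite (@simulE (i + b).+1) => [|m /hA //].
under [RHS]eq_bigr => k _.
  rewrite (@simulE (i + (b + c)).+1); last first.
    by move=> m hm; apply: hB; have := ltn_ord k; lia.
  rewrite big_distrr /=; over.
rewrite exchange_big /=; apply: eq_bigr => m _.
rewrite (@simulE (i + b).+1) => [|k /hA //].
by rewrite big_distrl /=; apply: eq_bigr => k _; rewrite mulrA.
Qed.

Lemma lower_banded A : pos_lower_bidiag A -> banded 1 A.
Proof. by move=> [_ _ h] i k hk; apply: h; lia. Qed.

Lemma upper_banded A : pos_upper_bidiag A -> banded 1 A.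
Proof. by move=> [_ _ h] i k hk; apply: h; lia. Qed.

(** * The refactorization of one adjacent pair *)

Lemma upper_mul A B i j : pos_upper_bidiag A ->
  simul A B i j = A i i * B i j + B i.+1 j.
Proof.
move=> uA; have [h1 _ h0] := uA.
rewrite (@simulE i.+2) => [|k hk]; last by apply: upper_banded => //; lia.
rewrite !big_ord_recr /= big1 ?add0r ?h1 ?mul1r // => k _.
by rewrite h0 ?mul0r //; have := ltn_ord k; lia.
Qed.

Lemma lower_mul0 A B j : pos_lower_bidiag A -> simul A B 0 j = B 0 j.
Proof.
move=> lA; have [h1 _ h0] := lA.
rewrite (@simulE 1) => [|k hk]; last by apply: h0; lia.
by rewrite big_ord1 h1 mul1r.
Qed.

Lemma lower_mulS A B i j : pos_lower_bidiag A ->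
  simul A B i.+1 j = A i.+1 i * B i j + B i.+1 j.
Proof.
move=> lA; have [h1 _ h0] := lA.
rewrite (@simulE i.+2) => [|k hk]; last by apply: h0; lia.
rewrite !big_ord_recr /= big1 ?add0r ?h1 ?mul1r // => k _.
by rewrite h0 ?mul0r //; have := ltn_ord k; lia.
Qed.

Definition lower_matrix (l : nat -> R) : simatrix R :=
  fun i j => if i == j then 1 else if i == j.+1 then l j else 0.
Definition upper_matrix (u : nat -> R) : simatrix R :=
  fun i j => if i == j then u i else if j == i.+1 then 1 else 0.

Lemma lower_matrixE A : pos_lower_bidiag A -> A = lower_matrix (fun n => A n.+1 n).
Proof.
move=> [h1 _ h0]; apply/funext => i; apply/funext => j; rewrite /lower_matrix.
by case: eqVneq => [->|/eqP ne] //; case: eqVneq => [->|/eqP ne'] //; exact: h0.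
Qed.

Lemma upper_matrixE A : pos_upper_bidiag A -> A = upper_matrix (fun n => A n n).
Proof.
move=> [h1 _ h0]; apply/funext => i; apply/funext => j; rewrite /upper_matrix.
by case: eqVneq => [->|/eqP ne] //; case: eqVneq => [->|/eqP ne'] //; exact: h0.
Qed.

Lemma lower_matrix_pos l : (forall n, 0 < l n) -> pos_lower_bidiag (lower_matrix l).
Proof.
move=> hl; rewrite /lower_matrix; split=> [n|n|i j /eqP/negPf -> /eqP/negPf -> //].
  by rewrite eqxx.
by rewrite eqxx; case: eqP => //; lia.
Qed.

Lemma upper_matrix_pos u : (forall n, 0 < u n) -> pos_upper_bidiag (upper_matrix u).
Proof.
move=> hu; rewrite /upper_matrix; split=> [n|n|i j /eqP/negPf -> /eqP/negPf -> //].
  by rewrite eqxx; case: eqP => //; lia.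
by rewrite eqxx.
Qed.

(** One step of the quotient-difference algorithm. The entries [(0, 0)],
    [(n.+1, n.+1)] and [(n.+1, n)] of [U L = L' U'] are the three equations; the
    superdiagonals agree because of the normalizations. *)
Definition qd_relations (u l l' u' : nat -> R) : Prop :=
  [/\ u' 0%N = u 0%N + l 0%N,
      forall n, l' n + u' n.+1 = u n.+1 + l n.+1 &
      forall n, l' n * u' n = u n.+1 * l n].

Lemma refactor_equation u l l' u' :
    (forall n, 0 < u n) -> (forall n, 0 < l n) ->
    (forall n, 0 < l' n) -> (forall n, 0 < u' n) ->
  simul (upper_matrix u) (lower_matrix l) =
    simul (lower_matrix l') (upper_matrix u') <-> qd_relations u l l' u'.
Proof.
move=> hu hl hl' hu'.
have pu := upper_matrix_pos hu; have pl' := lower_matrix_pos hl'.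
split=> [e|[e0 eS em]].
  have eij i j := congr1 (fun A : simatrix R => A i j) e; split.
  - have := eij 0%N 0%N; rewrite upper_mul // lower_mul0 //.
    by rewrite /lower_matrix /upper_matrix /= mulr1 => ->.
  - move=> n; have := eij n.+1 n.+1; rewrite upper_mul // lower_mulS //.
    rewrite /lower_matrix /upper_matrix !eqxx (gtn_eqF (ltnSn n)).
    by rewrite (gtn_eqF (ltnSn n.+1)) (ltn_eqF (ltnSn n)) !mulr1.
  - move=> n; have := eij n.+1 n; rewrite upper_mul // lower_mulS //.
    rewrite /lower_matrix /upper_matrix !eqxx (gtn_eqF (ltnSn n)).
    have -> : (n.+2 == n) = false by lia.
    have -> : (n.+2 == n.+1) = false by lia.
    have -> : (n == n.+2) = false by lia.
    by rewrite !addr0.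
apply/funext => i; apply/funext => j; rewrite upper_mul //.
case: i => [|i]; rewrite ?lower_mul0 ?lower_mulS //; rewrite /lower_matrix /upper_matrix.
  case: j => [|[|j]] //=; first by rewrite mulr1 e0.
    by rewrite mulr0 add0r.
  by rewrite mulr0 addr0.
case: (ltngtP i.+1 j) => h.
- have -> : (i == j) = false by lia.
  have -> : (i.+1 == j.+1) = false by lia.
  have -> : (i.+2 == j.+1) = false by lia.
  rewrite !mulr0 !add0r.
  by have -> : (i.+2 == j) = (j == i.+2) by lia.
- case: (eqVneq i j) => [<-|/eqP ne].
    have -> : (i.+2 == i) = false by lia.
    have -> : (i.+2 == i.+1) = false by lia.
    have -> : (i == i.+2) = false by lia.
    have -> : (i.+1 == i) = false by lia.
    by rewrite eqxx !addr0 em.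
  have -> : (i.+2 == j) = false by lia.
  have -> : (i.+1 == j.+1) = false by lia.
  have -> : (i.+2 == j.+1) = false by lia.
  have -> : (j == i.+2) = false by lia.
  by rewrite !mulr0 !add0r.
- rewrite -h !eqxx.
  have -> : (i.+2 == i.+1) = false by lia.
  have -> : (i == i.+1) = false by lia.
  have -> : (i.+1 == i) = false by lia.
  by rewrite !mulr1 eS.
Qed.

Fixpoint qd_upper (u l : nat -> R) (n : nat) : R :=
  match n with
  | 0 => u 0 + l 0
  | m.+1 => u m.+1 + l m.+1 - u m.+1 * l m / qd_upper u l m
  end.
Definition qd_lower (u l : nat -> R) (n : nat) : R :=
  u n.+1 * l n / qd_upper u l n.

(** Positivity of [u'] alone would not pass through the subtraction in the
    recursion; the stronger bound [l n < u' n] does, since it gives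
    [l' n < u n.+1]. *)
Lemma qd_upper_gt u l n : (forall n, 0 < u n) -> (forall n, 0 < l n) ->
  l n < qd_upper u l n.
Proof.
move=> hu hl; elim: n => [|n IH] /=; first by rewrite ltrDr.
have q0 : 0 < qd_upper u l n := lt_trans (hl n) IH.
suff : u n.+1 * l n / qd_upper u l n < u n.+1 by lra.
by rewrite ltr_pdivrMr // ltr_pM2l.
Qed.

Lemma qd_exists u l : (forall n, 0 < u n) -> (forall n, 0 < l n) ->
  [/\ forall n, 0 < qd_lower u l n, forall n, 0 < qd_upper u l n &
      qd_relations u l (qd_lower u l) (qd_upper u l)].
Proof.
move=> hu hl; have q0 n : 0 < qd_upper u l n.
  exact: lt_trans (hl n) (qd_upper_gt n hu hl).
split=> //; first by move=> n; rewrite divr_gt0 // mulr_gt0.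
split=> // n; first by rewrite /= addrC subrK.
by rewrite divfK // gt_eqF.
Qed.

Lemma qd_unique u l l' u' : (forall n, 0 < u' n) -> qd_relations u l l' u' ->
  l' = qd_lower u l /\ u' = qd_upper u l.
Proof.
move=> hu' [e0 eS em].
have el n : l' n = u n.+1 * l n / u' n by rewrite -em mulfK // gt_eqF.
have eu : u' = qd_upper u l.
  apply/funext; elim=> [|n IH] //=.
  by apply: (addrI (l' n)); rewrite eS el IH; ring.
by split=> //; apply/funext => n; rewrite el eu.
Qed.
(** Each [l' n] and each [u' n] is a term of a sum of nonnegative terms whose
    value is one of the [u m + l m]. *)
Lemma qd_bounded Cu Cl u l l' u' :
    (forall n, 0 < u n) -> (forall n, 0 < l n) ->
    (forall n, 0 < l' n) -> (forall n, 0 < u' n) -> qd_relations u l l' u' ->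
    (forall n, `|u n| <= Cu) -> (forall n, `|l n| <= Cl) ->
  (forall n, `|l' n| <= Cu + Cl) /\ (forall n, `|u' n| <= Cu + Cl).
Proof.
move=> hu hl hl' hu' [e0 eS _] bu bl.
have le_sum n : u n + l n <= Cu + Cl.
  by apply: lerD; rewrite (le_trans (ler_norm _)).
have le_l n : l' n <= Cu + Cl.
  by rewrite (le_trans _ (le_sum n.+1)) // -eS lerDl ltW.
have le_u n : u' n <= Cu + Cl.
  case: n => [|n]; first by rewrite e0.
  by rewrite (le_trans _ (le_sum n.+1)) // -eS lerDr ltW.
by split=> n; rewrite gtr0_norm.
Qed.

End MatrixProducts.

(** * Refactorizations of lists of factors *)

Section Refactorization.
Variable R : realType.
Implicit Types (A U L : simatrix R) (s t : seq (simatrix R)) (v w : seq symbol).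

Definition refactor_rule U L L' U' : Prop :=
  [/\ pos_upper_bidiag U, pos_lower_bidiag L, pos_lower_bidiag L',
      pos_upper_bidiag U' & simul U L = simul L' U'].

Lemma refactor_stepP s t : refactor_step s t <-> local_step refactor_rule s t.
Proof.
rewrite local_stepP; split.
  move=> [s1 [s2 [U [L [L' [U' [-> -> [uU lL] [lL' uU'] e]]]]]]].
  by exists s1, s2, U, L, L', U'.
move=> [s1 [s2 [U [L [L' [U' [-> -> [uU lL lL' uU' e]]]]]]]].
by exists s1, s2, U, L, L', U'.
Qed.

Lemma refactor_rule_qd U L L' U' : refactor_rule U L L' U' ->
  qd_relations (fun n => U n n) (fun n => L n.+1 n)
               (fun n => L' n.+1 n) (fun n => U' n n).
Proof.
move=> [uU lL lL' uU' e].
have [[_ pU _] [_ pL _] [_ pL' _] [_ pU' _]] := And4 uU lL lL' uU'.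
apply/(refactor_equation pU pL pL' pU').
by rewrite -(upper_matrixE uU) -(lower_matrixE lL) -(lower_matrixE lL') -(upper_matrixE uU').
Qed.

Lemma refactor_rule_exists U L : pos_upper_bidiag U -> pos_lower_bidiag L ->
  exists L' U', refactor_rule U L L' U'.
Proof.
move=> uU lL; have [[_ pU _] [_ pL _]] := (uU, lL).
have [pL' pU' qd] := qd_exists pU pL.
exists (lower_matrix (qd_lower (fun n => U n n) (fun n => L n.+1 n))).
exists (upper_matrix (qd_upper (fun n => U n n) (fun n => L n.+1 n))).
split=> //; [exact: lower_matrix_pos|exact: upper_matrix_pos|].
rewrite {1}(upper_matrixE uU) {1}(lower_matrixE lL).
exact/(refactor_equation pU pL pL' pU').
Qed.

Lemma refactor_rule_unique U L L1 U1 L2 U2 :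
  refactor_rule U L L1 U1 -> refactor_rule U L L2 U2 -> L1 = L2 /\ U1 = U2.
Proof.
move=> r1 r2; have [[_ _ lL1 uU1 _] [_ _ lL2 uU2 _]] := (r1, r2).
have [[_ p1 _] [_ p2 _]] := (uU1, uU2).
have [eL1 eU1] := qd_unique p1 (refactor_rule_qd r1).
have [eL2 eU2] := qd_unique p2 (refactor_rule_qd r2).
rewrite (lower_matrixE lL1) (lower_matrixE lL2) eL1 eL2.
by rewrite (upper_matrixE uU1) (upper_matrixE uU2) eU1 eU2.
Qed.

(** The entry below the diagonal is positive in a lower factor and zero in an
    upper one, so a list of factors determines its word. *)
Lemma has_type_unique x y A : has_type x A -> has_type y A -> x = y.
Proof.
case: x y => [] [] // [_ p0 h0] [_ p1 h1].
- by have := p0 0%N; rewrite h1 ?ltxx.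
- by have := p1 0%N; rewrite h0 ?ltxx.
Qed.

Lemma has_types_unique v w s : has_types v s -> has_types w s -> v = w.
Proof.
move=> h; elim: h w => {v s} [|x A v s hx _ IH] w hw;
  inversion hw as [|y ? w' ? hy hw'] => //; subst.
by rewrite (has_type_unique hx hy) (IH w').
Qed.

Lemma refactor_types v s t : local_step refactor_rule s t -> has_types v s ->
  exists2 w, local_step swap_rule v w & has_types w t.
Proof.
move=> st; elim: st v => {s t} [U L L' U' s [uU lL lL' uU' e]|A s t _ IH] v hv;
  inversion hv as [|x ? v' ? hx hv']; subst.
  inversion hv' as [|y ? v'' ? hy hv'']; subst.
  rewrite (has_type_unique hx (uU : has_type Upper U)).
  rewrite (has_type_unique hy (lL : has_type Lower L)).
  exists [:: Lower, Upper & v'']; first exact: local_here.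
  by do 2 constructor => //.
have [w vw hw] := IH _ hv'; exists (x :: w); first exact: local_there.
by constructor.
Qed.

Lemma swap_refactor v w s : local_step swap_rule v w -> has_types v s ->
  exists2 t, local_step refactor_rule s t & has_types w t.
Proof.
move=> vw; elim: vw s => {v w} [x y x' y' v [-> -> -> ->]|x v w _ IH] s hs;
  inversion hs as [|? A ? s' hx hs']; subst.
  inversion hs' as [|? B ? s'' hy hs'']; subst.
  have [L' [U' r]] := refactor_rule_exists hx hy.
  exists [:: L', U' & s'']; first exact: local_here.
  by have [_ _ lL' uU' _] := r; do 2 constructor => //.
have [t st ht] := IH _ hs'; exists (A :: t); first exact: local_there.
by constructor.
Qed.

Lemma exchanges_refactors v w s : exchanges v w -> has_types v s ->
  exists2 t, refactors s t & has_types w t.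
Proof.
move=> vw; elim: vw s => {v w} [v w /exchange_stepP vw|v|v w x _ IHv _ IHw] s hs.
- have [t st ht] := swap_refactor vw hs; exists t => //.
  by apply: rt_step; apply/refactor_stepP.
- by exists s => //; apply: rt_refl.
- have [t st /IHw [r tr hr]] := IHv _ hs.
  by exists r => //; exact: rt_trans st tr.
Qed.

Lemma refactors_exchanges v s t : refactors s t -> has_types v s ->
  exists2 w, exchanges v w & has_types w t.
Proof.
move=> st; elim: st v => {s t} [s t /refactor_stepP st|s|s t r _ IHs _ IHt] v hv.
- have [w vw hw] := refactor_types st hv; exists w => //.
  by apply: rt_step; apply/exchange_stepP.
- by exists v => //; apply: rt_refl.
- have [w vw /IHt [x wx hx]] := IHs _ hv.
  by exists x => //; exact: rt_trans vw wx.
Qed.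

(** The commuting square of two steps on disjoint pairs, the first of which acts
    at the head of the list. The pairs cannot overlap: the common factor would be
    both lower and upper. *)
Lemma refactor_square n U L L' U' s s' v1 v2 w :
    refactor_rule U L L' U' -> local_step refactor_rule (L :: s) s' ->
    has_types v1 [:: L', U' & s] -> has_types v2 (U :: s') ->
    dominated n v1 w -> dominated n v2 w ->
  exists s3 v3, [/\ local_step refactor_rule [:: L', U' & s] s3,
    local_step refactor_rule (U :: s') s3, has_types v3 s3 & dominated n v3 w].
Proof.
move=> rule ss'; have [uU lL lL' uU' _] := rule.
inversion ss' as [K ? ? ? ? [uK _ _ _ _]|? ? q sq]; subst.
  by have := @has_type_unique Upper Lower L uK lL.
move=> h1 h2.
inversion h1 as [|x1 ? ? ? hx1 h1']; subst.
inversion h1' as [|y1 ? u1 ? hy1 h1'']; subst.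
inversion h2 as [|x2 ? ? ? hx2 h2']; subst.
inversion h2' as [|y2 ? u2 ? hy2 h2'']; subst.
rewrite (has_type_unique hx1 (lL' : has_type Lower L')).
rewrite (has_type_unique hy1 (uU' : has_type Upper U')).
rewrite (has_type_unique hx2 (uU : has_type Upper U)).
rewrite (has_type_unique hy2 (lL : has_type Lower L)) => d1 d2.
exists [:: L', U' & q], [:: Lower, Upper & u2]; split.
- by do 2 apply: local_there.
- exact: local_here.
- by do 2 constructor => //.
- exact: dominated_join d1 d2.
Qed.

(** Local confluence relative to a target word [w]. Keeping the common reduct
    below [w] is what makes [w] reachable from it. The surplus [n] is general
    because the induction removes common first letters. *)
Lemma refactor_diamond n v1 v2 w s s1 s2 :
    local_step refactor_rule s s1 -> local_step refactor_rule s s2 ->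
    has_types v1 s1 -> has_types v2 s2 ->
    dominated n v1 w -> dominated n v2 w ->
  s1 = s2 \/ exists s3 v3, [/\ local_step refactor_rule s1 s3,
    local_step refactor_rule s2 s3, has_types v3 s3 & dominated n v3 w].
Proof.
move=> ss1; elim: ss1 n v1 v2 w s2 => {s s1}
  [U L L' U' r rule|A r r1 rr1 IH] n v1 v2 w s2 ss2.
  inversion ss2 as [? ? L2 U2 ? rule2|? ? q rq]; subst => h1 h2 d1 d2.
    by left; have [-> ->] := refactor_rule_unique rule rule2.
  right; exact: (refactor_square rule rq h1 h2 d1 d2).
inversion ss2 as [U L L' U' q rule|? ? r2 rr2]; subst => h1 h2 d1 d2.
  right; have [s3 [v3 [? ? ? ?]]] := refactor_square rule rr1 h2 h1 d2 d1.
  by exists s3, v3.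
inversion h1 as [|x1 ? u1 ? hx1 h1']; subst.
inversion h2 as [|x2 ? u2 ? hx2 h2']; subst.
have ex : x1 = x2 by apply: has_type_unique hx1 hx2.
subst x2.
(* [m] is the surplus left after the first letters of [v1] (or [v2]) and [w],
   and it depends only on these two letters. *)
have lift m y w' : dominated m u1 w' -> dominated m u2 w' ->
    (forall u3, dominated m u3 w' -> dominated n (x1 :: u3) (y :: w')) ->
  A :: r1 = A :: r2 \/ exists s3 v3, [/\ local_step refactor_rule (A :: r1) s3,
    local_step refactor_rule (A :: r2) s3, has_types v3 s3 & dominated n v3 (y :: w')].
  move=> e1 e2 up; have [->|[s3 [v3 [? ? ? ?]]]] := IH _ _ _ _ _ rr2 h1' h2' e1 e2.
    by left.
  right; exists (A :: s3), (x1 :: v3); split; try exact: local_there.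
    by constructor.
  exact: up.
by case: (x1) w d1 d2 lift => [] [|[] w] //=; [|case: n => //= n| |] =>
  d1 d2 lift; apply: (lift _ _ _ d1 d2).
Qed.

Lemma refactors_first s t : refactors s t ->
  s = t \/ exists2 r, local_step refactor_rule s r & refactors r t.
Proof.
elim=> {s t} [s t /refactor_stepP st|s|s t r _ IHs tr IHt]; [right|by left|].
  by exists t => //; exact: rt_refl.
case: IHs => [->//|[q sq qt]]; right.
by exists q => //; exact: rt_trans qt tr.
Qed.

(** Newman's argument by induction on the number of inversions: through the
    common reduct [s3] and some factors [g] of type [w] reachable from it, both
    results equal [g]. A list that is already of type [w] admits no step towards
    [w], since inversions would decrease. *)
Lemma refactors_unique w v s t t' : has_types v s ->
  refactors s t -> refactors s t' -> has_types w t -> has_types w t' -> t = t'.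
Proof.
have [n] := ubnP (inversions v); elim: n v s t t' => // n IH v s t t' le_n hv st st' ht ht'.
have typed r : local_step refactor_rule s r ->
    exists2 x, local_step swap_rule v x & has_types x r.
  by move=> /refactor_types; apply.
have reach (r : seq (simatrix R)) x y : refactors r y -> has_types x r ->
    has_types w y -> exchanges x w.
  move=> ry hr hy; have [z xz hz] := refactors_exchanges ry hr.
  by rewrite (has_types_unique hy hz).
have moved (r y : seq (simatrix R)) : local_step refactor_rule s r -> refactors r y ->
    has_types w y -> ~ has_types w s.
  move=> sr ry hy hs; have [x vx hx] := typed _ sr.
  have := inversions_exchanges (reach _ _ _ ry hx hy).
  by rewrite (has_types_unique hs hv) leqNgt (inversions_step vx).
case: (refactors_first st) (refactors_first st') => [est|[r sr rt]] [est'|[r' sr' rt']].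
- by rewrite -est.
- by rewrite -est in ht; case: (moved _ _ sr' rt' ht').
- by rewrite -est' in ht'; case: (moved _ _ sr rt ht).
have [[x vx hx] [x' vx' hx']] := (typed _ sr, typed _ sr').
have dx := exchanges_dominated (reach _ _ _ rt hx ht).
have dx' := exchanges_dominated (reach _ _ _ rt' hx' ht').
have lt_n y : local_step swap_rule v y -> (inversions y < n)%N.
  by move=> /inversions_step lt; exact: leq_trans lt le_n.
have [er|[s3 [v3 [rs3 rs3' h3 d3]]]] := refactor_diamond sr sr' hx hx' dx dx'.
  by rewrite -er in rt'; exact: IH (lt_n _ vx) hx rt rt' ht ht'.
have [g s3g hg] := exchanges_refactors (dominated_exchanges d3) h3.
have via r0 : local_step refactor_rule r0 s3 -> refactors r0 g.
  by move=> rs; apply: rt_trans s3g; apply: rt_step; apply/refactor_stepP.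
rewrite (IH _ _ _ _ (lt_n _ vx) hx rt (via _ rs3) ht hg).
by rewrite (IH _ _ _ _ (lt_n _ vx') hx' rt' (via _ rs3') ht' hg).
Qed.

Lemma siprod_local_step s t : local_step refactor_rule s t -> siprod s = siprod t.
Proof.
elim=> {s t} [U L L' U' s [uU lL lL' uU' e]|A s t _ /= -> //] /=.
rewrite -(simulA _ (upper_banded uU) (lower_banded lL)) e.
by rewrite (simulA _ (lower_banded lL') (upper_banded uU')).
Qed.

Lemma siprod_refactors s t : refactors s t -> siprod s = siprod t.
Proof.
elim=> {s t} [s t /refactor_stepP /siprod_local_step //|//|s t r _ -> _ ->//].
Qed.

(** Stated without reference to a word, so that it can be propagated along steps
    that change the word. *)
Definition bounded_factor A : Prop :=
  exists2 x, has_type x A & bounded_coefficients x A.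

Lemma bounded_factorP x A : has_type x A -> bounded_factor A ->
  bounded_coefficients x A.
Proof. by move=> hx [y hy]; rewrite (has_type_unique hx hy). Qed.

Lemma bounded_local_step s t : local_step refactor_rule s t ->
  List.Forall bounded_factor s -> List.Forall bounded_factor t.
Proof.
elim=> {s t} [U L L' U' s r|A s t _ IH] h; inversion h as [|? ? bA bs]; subst.
  inversion bs as [|? ? bL bs']; subst.
  have [uU lL lL' uU' _] := r.
  have [[_ pU _] [_ pL _] [_ pL' _] [_ pU' _]] := And4 uU lL lL' uU'.
  have [Cu hu] := bounded_factorP (uU : has_type Upper U) bA.
  have [Cl hl] := bounded_factorP (lL : has_type Lower L) bL.
  have [bL' bU'] := qd_bounded pU pL pL' pU' (refactor_rule_qd r) hu hl.
  constructor; first by exists Lower => //; exists (Cu + Cl).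
  by constructor=> //; exists Upper => //; exists (Cu + Cl).
by constructor=> //; exact: IH.
Qed.

Lemma bounded_refactors s t : refactors s t ->
  List.Forall bounded_factor s -> List.Forall bounded_factor t.
Proof.
elim=> {s t} [s t /refactor_stepP /bounded_local_step //|//|s t r _ IHs _ IHt].
by move/IHs/IHt.
Qed.

Lemma bounded_factors_types w s : has_types w s ->
  List.Forall bounded_factor s -> List.Forall2 (@bounded_coefficients R) w s.
Proof.
elim=> {w s} [//|x A w s hx _ IH] h; inversion h as [|? ? bA bs]; subst.
by constructor; [exact: bounded_factorP|exact: IH].
Qed.

End Refactorization.

(** * Heights and the index set *)

Lemma map_const (X : Type) (f : nat -> X) x m n :
  (forall k, (m <= k < m + n)%N -> f k = x) -> map f (iota m n) = nseq n x.
Proof.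
elim: n m => [//|n IH] m h /=; rewrite h ?IH // => [k hk|]; last by lia.
by apply: h; lia.
Qed.

Section MinimumHeight.
Variables p q : nat.
Hypotheses (hp : (1 <= p)%N) (hq : (1 <= q)%N).
Local Notation d := (gcdn p q).
Local Notation P := (redp p q).
Local Notation Q := (redq p q).
Local Notation M := (p + q)%N.

Lemma redpE : p = (P * d)%N. Proof. by rewrite divnK ?dvdn_gcdl. Qed.
Lemma redqE : q = (Q * d)%N. Proof. by rewrite divnK ?dvdn_gcdr. Qed.
Lemma redp_gt0 : (0 < P)%N.
Proof. by move: hp; rewrite {1}redpE muln_gt0 => /andP[]. Qed.
Lemma redq_gt0 : (0 < Q)%N.
Proof. by move: hq; rewrite {1}redqE muln_gt0 => /andP[]. Qed.
Lemma redrE : M = (d * redr p q)%N.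
Proof. by rewrite /redr mulnC mulnDl -redpE -redqE. Qed.
Lemma red_cross : (Q * p = P * q)%N.
Proof.
by move: redpE redqE; move: P Q d => x y z -> ->; rewrite mulnCA.
Qed.

Lemma ceil_div_gt (m x y : nat) : (0 < y)%N ->
  (m%:Z < Num.ceil (x%:R / y%:R : rat)) = (m * y < x)%N.
Proof.
move=> y0; rewrite ceil_gt_int ltr_pdivlMr ?ltr0n //.
by rewrite -[m%:~R]/(m%:R) -natrM ltr_nat.
Qed.

(** Membership in the index set without ceilings, from [m < ceil (x / y)] if and
    only if [m y < x]. Truncated predecessors make the case [a = p + 1] hold
    automatically, as it should: its word is the least one. *)
Definition cyclic_condition a : bool :=
  if (a <= p)%N then ((p - a) * Q < P)%N else ((a - p.+1).-1 * P < Q)%N.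

Lemma A_cycE a : (1 <= a <= M)%N -> (a \in A_cyc p q) = cyclic_condition a.
Proof.
move=> ha; rewrite /A_cyc inE /a_minus /a_plus /cyclic_condition.
have hm m : (m%:Z < c_minus p q) = (m * Q < P)%N by exact: ceil_div_gt redq_gt0.
have hc m : (m%:Z < c_plus p q) = (m * P < Q)%N by exact: ceil_div_gt redp_gt0.
have m0 : 0 < c_minus p q by have := hm 0%N; rewrite redp_gt0.
have c0 : 0 < c_plus p q by have := hc 0%N; rewrite redq_gt0.
case: (leqP a p) => hap.
  rewrite -hm; move: (c_minus p q) (c_plus p q) m0 c0 => x y x0 y0.
  by lia.
rewrite -hc; move: (c_minus p q) (c_plus p q) m0 c0 => x y x0 y0.
by lia.
Qed.

Lemma cyclic_word_left a : (1 <= a <= p)%N ->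
  cyclic_word p q a =
  nseq (p - a).+1 Lower ++ (nseq q Upper ++ nseq a.-1 Lower).
Proof.
move=> ha; rewrite /cyclic_word /cyclic_list.
have -> : (M.+1 - a = (p - a).+1 + q)%N by lia.
rewrite iotaD map_cat -catA; congr (_ ++ (_ ++ _)); apply: map_const => k hk;
  by case: leqP => //; lia.
Qed.

Lemma cyclic_word_right a : (p < a <= M)%N ->
  cyclic_word p q a =
  (nseq (M.+1 - a) Upper ++ nseq p Lower) ++ nseq (a - p.+1) Upper.
Proof.
move=> ha; rewrite /cyclic_word /cyclic_list.
have -> : (a.-1 = p + (a - p.+1))%N by lia.
rewrite iotaD map_cat catA; congr ((_ ++ _) ++ _); apply: map_const => k hk;
  by case: leqP => //; lia.
Qed.

Lemma cyclic_word_count a : (1 <= a <= M)%N ->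
  size (cyclic_word p q a) = M /\ count is_lower (cyclic_word p q a) = p.
Proof.
move=> ha; case: (leqP a p) => hap.
  have -> := @cyclic_word_left a ltac:(lia).
  by rewrite !size_cat !count_cat !size_nseq !count_nseq !mul1n mul0n; split; lia.
have -> := @cyclic_word_right a ltac:(lia).
by rewrite !size_cat !count_cat !size_nseq !count_nseq !mul1n !mul0n; split; lia.
Qed.

(** The final height of a word, in a form suited to concatenation. *)
Definition weight (w : seq symbol) : int :=
  \sum_(x <- w) match x with Lower => Q%:Z | Upper => - P%:Z end.

Lemma weight_cat v w : weight (v ++ w) = weight v + weight w.
Proof. by rewrite /weight big_cat. Qed.

Lemma weight_count w :
  weight w = Q%:Z * (count is_lower w)%:Z - P%:Z * (size w - count is_lower w)%N%:Z.
Proof.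
elim: w => [|x w IH]; first by rewrite /weight big_nil /=; lia.
rewrite -cat1s weight_cat IH size_cat count_cat.
have := count_size is_lower w; move: (count _ _) (size _) => c s hc.
rewrite /weight big_cons big_nil; case: x => /=.
  have -> : (1 + s - (1 + 0 + c) = s - c)%N by lia.
  by rewrite addn0 PoszD; ring.
have -> : (1 + s - (0 + 0 + c) = (s - c) + 1)%N by lia.
by rewrite !add0n PoszD; ring.
Qed.

Lemma weight_balanced w : size w = M -> count is_lower w = p -> weight w = 0.
Proof.
by move=> sw cw; rewrite weight_count sw cw addKn -!PoszM red_cross subrr.
Qed.

(** A leading run of [m] letters [Lower] ends at height [m Q], and a final run of
    [j] letters [Upper] begins at height [j P], because the total height is
    zero. *)
Lemma low_heights_cyclic a sigma : (1 <= a <= M)%N ->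
    exchanges (cyclic_word p q a) sigma ->
    (forall k, (k <= M)%N -> height p q sigma k < (redr p q)%:Z) ->
  cyclic_condition a.
Proof.
move=> ha e hs; have [sz cn] := cyclic_word_count ha.
have ss : size sigma = M by rewrite -(size_exchanges e).
have cs : count is_lower sigma = p by rewrite -(count_exchanges is_lower e).
have hw k : (k <= M)%N -> weight (take k sigma) < (redr p q)%:Z := hs k.
rewrite /redr in hw.
rewrite /cyclic_condition; case: (leqP a p) => hap.
  move: e; rewrite cyclic_word_left; last by lia.
  move=> /exchanges_prefix [w' ew]; have := hw (p - a).+1.
  rewrite ew take_size_cat ?size_nseq // weight_count count_nseq size_nseq.
  rewrite mul1n subnn mulr0 subr0 => /(_ _) h.
  by have {}h := h ltac:(lia); lia.
move: e; rewrite cyclic_word_right; last by lia.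
move=> /exchanges_suffix [w' ew].
have := weight_balanced ss cs; rewrite ew weight_cat.
rewrite [weight (nseq _ _)]weight_count count_nseq size_nseq mul0n mulr0 subn0.
have := hw (size w'); rewrite ew take_size_cat // => h.
have {}h := h ltac:(by rewrite -ss ew size_cat leq_addr).
case: (a - p.+1)%N h => [|j] h hj /=; first exact: redq_gt0.
by move: hj; rewrite -PoszM mulnS [(j * _)%N]mulnC; lia.
Qed.

Lemma span_bounds_heights sigma k : (k <= size sigma)%N ->
  height p q sigma k <= height_span p q sigma.
Proof.
move=> hk; rewrite /height_span.
apply: (@le_trans _ _ (\big[Num.max/0]_(0 <= i < (size sigma).+1) height p q sigma i)).
  by apply: (le_bigmax_seq 0 k xpredT (height p q sigma)) => //; rewrite mem_index_iota.
by rewrite lerDl oppr_ge0 bigmin_le_id.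
Qed.

(** The rule for the next letter of [sigma_min] is addition of [Q] modulo
    [R = P + Q]: subtracting [P] is adding [Q] and reducing once. *)
Lemma sigma_min_heights k : (k <= M)%N ->
  height p q (sigma_min p q) k = ((k * Q) %% redr p q)%N%:Z.
Proof.
have [P0 Q0] := (redp_gt0, redq_gt0).
elim: k => [|k IH] hk; first by rewrite /height take0 big_nil mul0n mod0n.
have -> : height p q (sigma_min p q) k.+1 = weight (take k.+1 (sigma_min p q)) by [].
rewrite (take_nth Lower) ?size_mkseq // nth_mkseq // -cats1 weight_cat.
rewrite [weight (take k _)]IH; last exact: ltnW.
rewrite /weight big_cons big_nil mulSn addnC modnD; last by rewrite addn_gt0 P0.
rewrite (modn_small (_ : (Q < redr p q)%N)); last by rewrite /redr; lia.
have : ((k * Q) %% redr p q < redr p q)%N by rewrite ltn_mod addn_gt0 P0.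
move: ((k * Q) %% redr p q)%N => r; rewrite /redr => hr.
by case: (ltnP r P) => h; case: leqP => h'; lia.
Qed.

Lemma sigma_min_count : count is_lower (sigma_min p q) = p.
Proof.
have := sigma_min_heights (leqnn M).
have -> : height p q (sigma_min p q) M = weight (take M (sigma_min p q)) by [].
rewrite {2}redrE mulnAC modnMl take_oversize ?size_mkseq // weight_count size_mkseq.
have := count_size is_lower (sigma_min p q); rewrite size_mkseq.
move: (count _ _) => c hc h.
have {}h : (Q * c = P * (M - c))%N by lia.
have e : (redr p q * c = redr p q * p)%N.
  rewrite /redr !mulnDl h red_cross -!mulnDr.
  by rewrite subnKC.
by move/eqP: e; rewrite eqn_pmul2l ?addn_gt0 ?redp_gt0 // => /eqP.
Qed.

(** Removing the extreme run that the cyclic word shares with [sigma_min] leaves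
    a least word on one side, so only the letters have to be counted. *)
Lemma cyclic_exchanges a : (1 <= a <= M)%N -> cyclic_condition a ->
  exchanges (cyclic_word p q a) (sigma_min p q).
Proof.
have [P0 Q0] := (redp_gt0, redq_gt0).
move=> ha; rewrite /cyclic_condition; case: (leqP a p) => hap hc.
  rewrite cyclic_word_left; last by lia.
  have hM : M = ((p - a).+1 + (M - (p - a).+1))%N by lia.
  have := sigma_min_count; rewrite /sigma_min /mkseq hM iotaD map_cat.
  (* The remainders [k Q] of the first letters have not yet wrapped around. *)
  rewrite (map_const (x := Lower)) => [|k hk]; last first.
    rewrite modn_small.
      by rewrite ifT //; nia.
    by rewrite /redr; nia.
  rewrite count_cat count_nseq mul1n => cn.
  rewrite -[nseq _ Lower ++ map _ _]cats0 -catA -[nseq q _ ++ _]cats0.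
  apply: exchanges_context; apply: exchanges_bottom.
    by rewrite size_map size_iota; lia.
  by lia.
rewrite cyclic_word_right; last by lia.
have hM : M = (M - (a - p.+1) + (a - p.+1))%N by lia.
have := sigma_min_count; rewrite /sigma_min /mkseq hM iotaD map_cat -hM.
rewrite (@map_const _ _ Upper (0 + _)) => [|k hk]; last first.
  have [i hi hk'] : exists2 i, (k + i = M)%N & (0 < i <= a - p.+1)%N.
    by exists (M - k)%N; lia.
  rewrite ifF //; apply/negbTE; rewrite -leqNgt.
  (* From the end, [(M - i) Q] is congruent to [i P], as [M Q] and [i R] are
     multiples of [R]. *)
  have e : (k * Q + i * redr p q = i * P + d * Q * redr p q)%N.
    have -> : (d * Q * redr p q = (k + i) * Q)%N by rewrite hi redrE mulnAC.
    by rewrite /redr; ring.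
  have -> : ((k * Q) %% redr p q = i * P)%N.
    rewrite -(modnMDl i) addnC e addnC modnMDl modn_small //.
    by rewrite /redr; nia.
  by nia.
rewrite count_cat count_nseq mul0n addn0 => cn.
apply: (@exchanges_context [::] _ _ _); apply: exchanges_bottom => //.
by rewrite size_map size_iota; lia.
Qed.

End MinimumHeight.

(** * The factors of the cyclic products *)

Section CyclicFactors.
Variables (R : realType) (p q : nat) (L U : nat -> simatrix R).
Hypothesis lowerL : forall i, (1 <= i <= p)%N -> pos_lower_bidiag (L i).
Hypothesis upperU : forall b, (1 <= b <= q)%N -> pos_upper_bidiag (U b).

Lemma factor_list :
  map L (iota 1 p) ++ rev (map U (iota 1 q)) =
  map (factor p q L U) (iota 1 (p + q)).
Proof.
rewrite iotaD map_cat; congr (_ ++ _).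
  by apply/eq_in_map => k; rewrite mem_iota /factor => hk; rewrite ifT //; lia.
apply: (@eq_from_nth _ (@sione R)); rewrite size_rev !size_map !size_iota // => i hi.
rewrite nth_rev ?size_map ?size_iota // (nth_map 0%N) ?size_iota; last by lia.
rewrite (nth_map 0%N) ?size_iota // !nth_iota //; last by lia.
by rewrite /factor ifF; [congr U|]; lia.
Qed.

(** Words and factors are images of one list of indices, which reduces the two
    lemmas below to single indices. *)
Lemma cyclic_list_indices (X : Type) M a (f : nat -> X) :
  cyclic_list M a f = map f (cyclic_list M a id).
Proof. by rewrite /cyclic_list map_cat !map_id. Qed.

Lemma mem_cyclic_indices M a k : (1 <= a <= M)%N ->
  k \in cyclic_list M a id -> (1 <= k <= M)%N.
Proof. by rewrite /cyclic_list !map_id mem_cat !mem_iota; lia. Qed.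

Lemma cyclic_factors_types a : (1 <= a <= p + q)%N ->
  has_types (cyclic_word p q a) (cyclic_factors p q L U a).
Proof.
move=> ha; rewrite /cyclic_word /cyclic_factors.
rewrite [cyclic_list _ _ _]cyclic_list_indices.
rewrite [cyclic_list _ _ (factor _ _ _ _)]cyclic_list_indices.
have := @mem_cyclic_indices (p + q) a ^~ ha.
elim: (cyclic_list _ _ _) => [|k s IH] hs /=; first by constructor.
have hk := hs k (mem_head _ _).
constructor; last by apply: IH => j js; apply: hs; rewrite inE js orbT.
by rewrite /factor; case: leqP => h; [apply: lowerL|apply: upperU]; lia.
Qed.

Lemma cyclic_factors_bounded a : (1 <= a <= p + q)%N ->
    (forall i, (1 <= i <= p)%N -> bounded_coefficients Lower (L i)) ->
    (forall b, (1 <= b <= q)%N -> bounded_coefficients Upper (U b)) ->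
  List.Forall (@bounded_factor R) (cyclic_factors p q L U a).
Proof.
move=> ha bL bU; rewrite /cyclic_factors cyclic_list_indices.
have := @mem_cyclic_indices (p + q) a ^~ ha.
elim: (cyclic_list _ _ _) => [|k s IH] hs /=; first by constructor.
have hk := hs k (mem_head _ _).
constructor; last by apply: IH => j js; apply: hs; rewrite inE js orbT.
rewrite /factor; case: leqP => h.
  by exists Lower; [apply: lowerL|apply: bL]; lia.
by exists Upper; [apply: upperU|apply: bU]; lia.
Qed.

End CyclicFactors.

Theorem theorem2p8 (R : realType) (p q : nat) (hp : (1 <= p)%N) (hq : (1 <= q)%N)
    (L U : nat -> simatrix R) (T : simatrix R)
    (hT : positive_bidiagonal_factorization p q L U T)
    (a : nat) (ha : (1 <= a <= p + q)%N) :
  [/\ T = siprod (map (factor p q L U) (iota 1 (p + q))),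
      a \in A_cyc p q <->
        (exists G : seq (simatrix R),
           refactors (cyclic_factors p q L U a) G /\ has_types (sigma_min p q) G),
      forall G : seq (simatrix R),
        refactors (cyclic_factors p q L U a) G -> has_types (sigma_min p q) G ->
        [/\ forall G' : seq (simatrix R),
              refactors (cyclic_factors p q L U a) G' ->
              has_types (sigma_min p q) G' -> G' = G,
            cyclic_product p q L U a = siprod G &
            (forall i, (1 <= i <= p)%N -> bounded_coefficients Lower (L i)) ->
            (forall b, (1 <= b <= q)%N -> bounded_coefficients Upper (U b)) ->
            List.Forall2 (@bounded_coefficients R) (sigma_min p q) G] &
      forall sigma : seq symbol,
        exchanges (cyclic_word p q a) sigma ->
        height_span p q sigma = (redr p q)%:Z - 1 ->
        exchanges (cyclic_word p q a) (sigma_min p q)].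
Proof.
have [lowerL upperU ->] := hT.
have types := cyclic_factors_types lowerL upperU ha.
rewrite factor_list A_cycE //; split=> //.
- split=> [/(cyclic_exchanges hp hq ha) e|[G [FG hG]]].
    by have [G FG hG] := exchanges_refactors e types; exists G.
  have [w e hw] := refactors_exchanges FG types.
  rewrite (has_types_unique hw hG) in e.
  apply: (low_heights_cyclic hp hq ha e) => k hk.
  by rewrite sigma_min_heights // ltz_nat ltn_mod addn_gt0 redp_gt0.
- move=> G FG hG; split=> [G' FG' hG'||bL bU].
  + exact: refactors_unique types FG' FG hG' hG.
  + exact: siprod_refactors FG.
  + apply: bounded_factors_types hG _; apply: bounded_refactors FG _.
    exact: cyclic_factors_bounded.
- move=> sigma e span; apply: cyclic_exchanges => //.
  apply: (low_heights_cyclic hp hq ha e) => k hk.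
  have hs : (k <= size sigma)%N.
    by rewrite -(size_exchanges e); have [-> _] := cyclic_word_count hp hq ha.
  by apply: le_lt_trans (span_bounds_heights _ _ hs) _; rewrite span; lia.
Qed.
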